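(* Suppose $\theta>0$ and $n\in(0,1)$. Then the solution $H\in C^1([0,1])\cap C^3((0,1))$ of the problem $$H^{n-1}\frac{d^3H}{dx^3}=-1+x\ \text{ for } x\in(0,1),\qquad \Big(H,\frac{dH}{dx}\Big)=(0,\theta)\ \text{ at } x=0,\qquad \frac{dH}{dx}=0\ \text{ at } x=1$$ is unique.
   Context: The unknown $H$ is the height of a film and the differential equation is understood on the set where $H>0$; thus a (classical) solution is a function $H\in C^1([0,1])\cap C^3((0,1))$ that is positive on $(0,1)$ and satisfies the equation and boundary conditions. *)

(* Defs.v *)
From Stdlib Require Import Reals.
From Coquelicot Require Import Coquelicot.
Open Scope R_scope.

Definition Icc (a b x : R) : Prop := a <= x <= b.

(* [D_in] takes the limit of the difference quotient along points of [D] only,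
   so at an end point of [Icc a b] this is the one-sided derivative. It reads
   its second argument at [x] only, hence the constant function. *)
Definition is_derive_within (D : R -> Prop) (f : R -> R) (x l : R) : Prop :=
  D_in f (fun _ => l) D x.

Definition C1_closed (a b : R) (f : R -> R) : Prop :=
  exists df : R -> R, forall x : R, Icc a b x ->
    is_derive_within (Icc a b) f x (df x) /\ continue_in df (Icc a b) x.

Definition Ck_open (k : nat) (a b : R) (f : R -> R) : Prop :=
  forall (j : nat) (x : R), (j <= k)%nat -> a < x < b ->
    ex_derive_n f j x /\ continuous (Derive_n f j) x.

(* The film height is a function on [0,1], represented by a total function on R
   of which nothing is required outside [0,1]. Since H > 0 on (0,1), [Rpower]
   is there the usual real power. *)
Record film_solution (theta n : R) (H : R -> R) : Prop := {
  film_C1 : C1_closed 0 1 H;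
  film_C3 : Ck_open 3 0 1 H;
  film_pos : forall x : R, 0 < x < 1 -> 0 < H x;
  film_ode : forall x : R, 0 < x < 1 ->
    Rpower (H x) (n - 1) * Derive_n H 3 x = -1 + x;
  film_height0 : H 0 = 0;
  film_slope0 : is_derive_within (Icc 0 1) H 0 theta;
  film_slope1 : is_derive_within (Icc 0 1) H 1 0
}.

(* Main.v *)
(** The slope [v = H'] solves [v'' = -(1-x) H^(1-n)], [v 0 = theta], [v 1 = 0],
    and [H = int v]: thus [H] is a fixed point of an operator that is monotone
    and, since [0 < 1-n < 1], sublinear. Concretely, if [H1 >= t H2] with
    [0 < t <= 1], then [u = H1' - t^(1-n) H2'] is concave and nonnegative at
    both ends, so [u >= 0] and [H1 >= t^(1-n) H2]. As [t^(1-n) > t] for [t < 1],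
    the largest admissible [t] is [1]; exchange [H1] and [H2]. It is positive
    to begin with because [H1 >= theta x / 2] and [H2 <= M x]. *)

Require Import Defs.
From Stdlib Require Import Reals Lra Lia.
From Coquelicot Require Import Coquelicot.
Open Scope R_scope.

(** * Continuous extension from a closed interval to the line *)

Definition clamp (a b x : R) : R := Rmax a (Rmin b x).

Lemma clamp_Icc (a b x : R) : a <= b -> Icc a b (clamp a b x).
Proof.
  unfold Icc, clamp, Rmax, Rmin; intros.
  destruct (Rle_dec b x), (Rle_dec a _); lra.
Qed.

Lemma clamp_id (a b x : R) : Icc a b x -> clamp a b x = x.
Proof.
  unfold Icc, clamp, Rmax, Rmin; intros.
  destruct (Rle_dec b x), (Rle_dec a _); lra.
Qed.

Lemma clamp_lipschitz (a b x y : R) :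
  Rabs (clamp a b x - clamp a b y) <= Rabs (x - y).
Proof.
  unfold clamp, Rmax, Rmin.
  destruct (Rle_dec b x), (Rle_dec b y);
    repeat destruct (Rle_dec a _); unfold Rabs; repeat destruct Rcase_abs; lra.
Qed.

(** [clamp] is a 1-Lipschitz retraction onto [[a, b]], so continuity relative to the interval
    becomes two-sided continuity, which the mean value theorem expects at end points. *)
Lemma continuity_clamp (a b : R) (f : R -> R) :
  a <= b -> (forall x, Icc a b x -> continue_in f (Icc a b) x) ->
  continuity (fun x => f (clamp a b x)).
Proof.
  intros hab hf x eps heps.
  destruct (hf _ (clamp_Icc a b x hab) eps heps) as [d [hd h]].
  exists d; split; [exact hd|]; intros y [_ hy]; simpl in *.
  unfold Rdist in *.
  (* [continue_in] excludes the base point itself, so equal clamped points are treated apart. *)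
  destruct (Req_dec (clamp a b x) (clamp a b y)) as [e | ne].
  - rewrite e, Rminus_diag, Rabs_R0; exact heps.
  - apply h; split.
    + split; [apply clamp_Icc; exact hab | exact ne].
    + apply Rle_lt_trans with (2 := hy), clamp_lipschitz.
Qed.

(** * One-sided derivatives *)

Lemma is_derive_within_interior (a b : R) (f : R -> R) (x l : R) :
  a < x < b -> is_derive_within (Icc a b) f x l -> is_derive f x l.
Proof.
  intros hx hf; apply is_derive_Reals; intros eps heps.
  destruct (hf eps heps) as [d [hd h]]; simpl in h; unfold Rdist in h.
  assert (hm : 0 < Rmin d (Rmin (x - a) (b - x)))
    by (repeat apply Rmin_glb_lt; lra).
  exists (mkposreal _ hm); simpl; intros k hk hkm.
  assert (h1 := Rmin_l d (Rmin (x - a) (b - x))).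
  assert (h2 := Rmin_r d (Rmin (x - a) (b - x))).
  assert (h3 := Rmin_l (x - a) (b - x)).
  assert (h4 := Rmin_r (x - a) (b - x)).
  assert (hk' : - (x - a) < k < b - x) by (apply Rabs_def2 in hkm; lra).
  specialize (h (x + k)).
  replace (x + k - x) with k in h by ring.
  apply h; split; [|lra].
  unfold D_x, Icc; lra.
Qed.

(** Each point of the interval is an accumulation point of it: from the right when [x < b], from the
    left at [b]. Limits there are thus unique. *)
Lemma is_derive_within_unique (a b : R) (f : R -> R) (x l1 l2 : R) :
  a < b -> Icc a b x ->
  is_derive_within (Icc a b) f x l1 -> is_derive_within (Icc a b) f x l2 ->
  l1 = l2.
Proof.
  intros hab [hax hxb] h1 h2.
  refine (single_limit _ _ _ _ _ _ h1 h2).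
  intros d hd; unfold D_x, Icc, Rdist.
  destruct (Rlt_le_dec x b) as [h | h].
  - exists (x + Rmin (d / 2) (b - x)).
    assert (0 < Rmin (d / 2) (b - x)) by (apply Rmin_glb_lt; lra).
    assert (e1 := Rmin_l (d / 2) (b - x)); assert (e2 := Rmin_r (d / 2) (b - x)).
    split; [lra | apply Rabs_def1; lra].
  - exists (x - Rmin (d / 2) (x - a)).
    assert (0 < Rmin (d / 2) (x - a)) by (apply Rmin_glb_lt; lra).
    assert (e1 := Rmin_l (d / 2) (x - a)); assert (e2 := Rmin_r (d / 2) (x - a)).
    split; [lra | apply Rabs_def1; lra].
Qed.

(** * Mean value theorem, concavity and monotonicity *)

Lemma MVT_open (f df : R -> R) (a b : R) :
  a < b -> (forall x, a < x < b -> is_derive f x (df x)) ->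
  (forall x, a <= x <= b -> continuity_pt f x) ->
  exists c, a < c < b /\ f b - f a = df c * (b - a).
Proof.
  intros hab hd hc.
  assert (pr : forall c, a < c < b -> derivable_pt f c).
  { intros c h; exists (df c); apply is_derive_Reals, hd, h. }
  destruct (MVT f id a b pr (fun c _ => derivable_pt_id c) hab hc
    (fun c _ => derivable_continuous_pt _ _ (derivable_pt_id c)))
    as [c [h e]].
  exists c; split; [exact h|].
  rewrite derive_pt_id in e.
  replace (derive_pt f c (pr c h)) with (df c) in e.
  - unfold id in e; lra.
  - symmetry; apply derive_pt_eq_0, is_derive_Reals, hd, h.
Qed.

(** If [u x < 0], the mean slope is negative on [[a, x]] and positive on [[x, b]], so [du] increases
    between two points, against [ddu <= 0]. *)
Lemma concave_nonneg (u du ddu : R -> R) (a b : R) :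
  (forall x, a <= x <= b -> continuity_pt u x) ->
  (forall x, a < x < b -> is_derive u x (du x)) ->
  (forall x, a < x < b -> is_derive du x (ddu x)) ->
  (forall x, a < x < b -> ddu x <= 0) ->
  0 <= u a -> 0 <= u b -> forall x, a <= x <= b -> 0 <= u x.
Proof.
  intros hc h1 h2 hneg ha hb x hx.
  destruct (Rle_lt_dec 0 (u x)) as [h | h]; [exact h | exfalso].
  assert (hax : a < x).
  { destruct (Req_dec a x) as [e | e]; [rewrite <- e in h|]; lra. }
  assert (hxb : x < b).
  { destruct (Req_dec x b) as [e | e]; [rewrite e in h|]; lra. }
  destruct (MVT_open u du a x) as [c1 [hc1 e1]]; try lra.
  { intros; apply h1; lra. }
  { intros; apply hc; lra. }
  destruct (MVT_open u du x b) as [c2 [hc2 e2]]; try lra.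
  { intros; apply h1; lra. }
  { intros; apply hc; lra. }
  destruct (MVT_open du ddu c1 c2) as [c3 [hc3 e3]]; try lra.
  { intros; apply h2; lra. }
  { intros y hy; apply derivable_continuous_pt.
    exists (ddu y); apply is_derive_Reals, h2; lra. }
  assert (hn : ddu c3 <= 0) by (apply hneg; lra).
  assert (du c1 < 0) by nra.
  assert (0 < du c2) by nra.
  nra.
Qed.

Lemma nondecreasing_nonneg (w dw : R -> R) (a b : R) :
  (forall x, a <= x <= b -> continuity_pt w x) ->
  (forall x, a < x < b -> is_derive w x (dw x)) ->
  (forall x, a < x < b -> 0 <= dw x) ->
  0 <= w a -> forall x, a <= x <= b -> 0 <= w x.
Proof.
  intros hc hd hpos ha x hx.
  destruct (Req_dec a x) as [<- | e]; [exact ha|].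
  destruct (MVT_open w dw a x) as [c [h1 h2]]; try lra.
  { intros; apply hd; lra. }
  { intros; apply hc; lra. }
  assert (0 <= dw c) by (apply hpos; lra).
  nra.
Qed.

Lemma Rpower_le_1 (t m : R) : 0 < t <= 1 -> 0 <= m -> Rpower t m <= 1.
Proof.
  intros ht hm; unfold Rpower; rewrite <- exp_0.
  assert (h : ln t <= 0) by (rewrite <- ln_1; apply ln_le; lra).
  destruct (Req_dec (m * ln t) 0) as [-> | e]; [lra|].
  left; apply exp_increasing; nra.
Qed.

(* A solution whose height [F] and slope [G] are continuous on all of [R], so
   that no one-sided notions are needed at the end points. *)
Record film_profile (theta m : R) (F G K : R -> R) : Prop := {
  profile_contF : continuity F;
  profile_contG : continuity G;
  profile_dF : forall x, 0 < x < 1 -> is_derive F x (G x);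
  profile_dG : forall x, 0 < x < 1 -> is_derive G x (K x);
  profile_dK : forall x, 0 < x < 1 ->
    is_derive K x (- (1 - x) * Rpower (F x) m);
  profile_pos : forall x, 0 < x < 1 -> 0 < F x;
  profile_F0 : F 0 = 0;
  profile_G0 : G 0 = theta;
  profile_G1 : G 1 = 0
}.

(** * From solutions to profiles *)

Lemma locally_open_interval (a b x : R) (P : R -> Prop) :
  a < x < b -> (forall y, a < y < b -> P y) -> locally x P.
Proof.
  intros hx hP.
  apply (locally_interval P x a b); simpl; try lra.
  intros y h1 h2; apply hP; simpl in *; lra.
Qed.

Lemma film_solution_profile (theta n : R) (H : R -> R) :
  film_solution theta n H ->
  exists F G K, film_profile theta (1 - n) F G K /\
    forall x, 0 <= x <= 1 -> F x = H x.
Proof.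
  intros [[dH hC1] hC3 hpos hode h0 hs0 hs1].
  set (F := fun x => H (clamp 0 1 x)); set (G := fun x => dH (clamp 0 1 x)).
  assert (hF : forall x, 0 <= x <= 1 -> F x = H x).
  { intros x hx; unfold F; rewrite clamp_id; [reflexivity | exact hx]. }
  assert (hG : forall x, 0 <= x <= 1 -> G x = dH x).
  { intros x hx; unfold G; rewrite clamp_id; [reflexivity | exact hx]. }
  assert (hd : forall x, 0 < x < 1 -> is_derive H x (G x)).
  { intros x hx; rewrite hG by lra.
    apply (is_derive_within_interior 0 1); [exact hx|].
    apply hC1; unfold Icc; lra. }
  assert (i0 : Icc 0 1 0) by (unfold Icc; lra).
  assert (i1 : Icc 0 1 1) by (unfold Icc; lra).
  exists F, G, (Derive_n H 2); split; [|exact hF]; split.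
  - apply continuity_clamp; [lra|].
    intros x hx; apply (cont_deriv _ (fun _ => dH x)), hC1, hx.
  - apply continuity_clamp; [lra|].
    intros x hx; apply hC1, hx.
  - intros x hx; apply (is_derive_ext_loc H); [|apply hd, hx].
    apply (locally_open_interval 0 1); [exact hx|].
    intros y hy; symmetry; apply hF; lra.
  - intros x hx; apply (is_derive_ext_loc (Derive_n H 1)).
    + apply (locally_open_interval 0 1); [exact hx|].
      intros y hy; apply is_derive_unique, hd, hy.
    (* [ex_derive_n H 2] is differentiability of [Derive_n H 1]: the index exceeds by one the order
       of the function differentiated. *)
    + apply Derive_correct, (hC3 2%nat x); [lia | exact hx].
  - intros x hx.
    replace (- (1 - x) * Rpower (F x) (1 - n)) with (Derive_n H 3 x).
    + apply Derive_correct, (hC3 3%nat x); [lia | exact hx].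
    (* Multiplying the equation by [H^(1-n)] cancels the power of [H]. *)
    + rewrite hF by lra.
      replace (- (1 - x)) with (-1 + x) by ring.
      rewrite <- (hode x hx), Rmult_comm, <- Rmult_assoc, <- Rpower_plus.
      replace (1 - n + (n - 1)) with 0 by ring.
      rewrite Rpower_O; [ring | apply hpos, hx].
  - intros x hx; rewrite hF by lra; apply hpos, hx.
  - rewrite hF by lra; exact h0.
  (* [dH] is only some witness of [C1_closed]; uniqueness of one-sided derivatives identifies its
     end values with the prescribed slopes. *)
  - rewrite hG by lra.
    apply (is_derive_within_unique 0 1 H 0); [lra | exact i0 | | exact hs0].
    apply hC1, i0.
  - rewrite hG by lra.
    apply (is_derive_within_unique 0 1 H 1); [lra | exact i1 | | exact hs1].
    apply hC1, i1.
Qed.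

(** * Linear bounds and comparison of profiles *)

Section Profiles.

Variables (theta m : R) (F1 G1 K1 F2 G2 K2 : R -> R).
Hypothesis htheta : 0 < theta.
Hypothesis p1 : film_profile theta m F1 G1 K1.
Hypothesis p2 : film_profile theta m F2 G2 K2.

(* The slope is concave, hence lies above its chord [theta (1 - x)]. *)
Lemma profile_lower_bound (x : R) : 0 <= x <= 1 -> theta / 2 * x <= F1 x.
Proof using htheta p1.
  destruct p1 as [cF cG dF dG dK _ e0 e1 e2].
  assert (hG : forall y, 0 <= y <= 1 -> 0 <= G1 y - theta * (1 - y)).
  { apply (concave_nonneg (fun y => G1 y - theta * (1 - y))
      (fun y => K1 y + theta) (fun y => - (1 - y) * Rpower (F1 y) m)).
    - intros y _; apply continuity_pt_minus; [apply cG | reg].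
    - intros y hy; evar_last.
      apply @is_derive_minus; [apply dG, hy|]; auto_derive; [exact I|].
      reflexivity.
      unfold minus, plus, opp; simpl; ring.
    - intros y hy; evar_last.
      apply @is_derive_plus; [apply dK, hy | apply @is_derive_const].
      unfold plus, zero; simpl; ring.
    - intros y hy; assert (h := exp_pos (m * ln (F1 y))); unfold Rpower; nra.
    - rewrite e1; lra.
    - rewrite e2; lra. }
  intros hx.
  (* The chord bound integrated from [0]. The result exceeds [theta / 2 * x] by
     [theta * x * (1 - x) / 2], which is nonnegative. *)
  assert (h : 0 <= F1 x - theta * (x - x * x / 2)).
  { apply (nondecreasing_nonneg (fun y => F1 y - theta * (y - y * y / 2))
      (fun y => G1 y - theta * (1 - y)) 0 1); [| | | |exact hx].
    - intros y _; apply continuity_pt_minus; [apply cF | reg].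
    - intros y hy; evar_last.
      apply @is_derive_minus; [apply dF, hy|]; auto_derive; [exact I|].
      reflexivity.
      unfold minus, plus, opp; simpl; field.
    - intros y hy; apply hG; lra.
    - rewrite e0; lra. }
  assert (0 <= theta * (x * (1 - x))) by (apply Rmult_le_pos; nra).
  nra.
Qed.

Lemma profile_upper_bound :
  exists M, 0 < M /\ forall x, 0 <= x <= 1 -> F1 x <= M * x.
Proof using p1.
  destruct p1 as [cF cG dF dG dK _ e0 e1 e2].
  destruct (continuity_ab_maj G1 0 1) as [c [hc _]]; [lra | auto |].
  (* [G1 c] is the maximal slope on [[0, 1]]; [Rmax 1] makes the constant positive. *)
  exists (Rmax 1 (G1 c)); split; [assert (h := Rmax_l 1 (G1 c)); lra|].
  intros x hx.
  assert (h : 0 <= Rmax 1 (G1 c) * x - F1 x); [|lra].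
  apply (nondecreasing_nonneg (fun y => Rmax 1 (G1 c) * y - F1 y)
    (fun y => Rmax 1 (G1 c) - G1 y) 0 1); [| | | |exact hx].
  - intros y _; apply continuity_pt_minus; [reg | apply cF].
  - intros y hy; apply @is_derive_minus; [|apply dF, hy].
    auto_derive; [exact I | ring].
  - intros y hy; assert (h := Rmax_r 1 (G1 c)).
    assert (G1 y <= G1 c) by (apply hc; lra); lra.
  - rewrite e0; lra.
Qed.

(** The power in the equation turns the factor [t] into [t^m] for the second derivatives of the
    slopes; concavity passes it to the slopes, integration to the heights. *)
Lemma profile_improve (t : R) :
  0 <= m -> 0 < t <= 1 ->
  (forall x, 0 <= x <= 1 -> t * F2 x <= F1 x) ->
  forall x, 0 <= x <= 1 -> Rpower t m * F2 x <= F1 x.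
Proof using htheta p1 p2.
  intros hm ht hle.
  destruct p1 as [cF cG dF dG dK pos e0 e1 e2].
  destruct p2 as [cF' cG' dF' dG' dK' pos' e0' e1' e2'].
  set (s := Rpower t m).
  assert (hs : s <= 1).
  { apply Rpower_le_1; lra. }
  assert (lin : forall f g x a b, is_derive f x a -> is_derive g x b ->
    is_derive (fun y => f y - s * g y) x (a - s * b)).
  { intros f g x a b hf hg; apply @is_derive_minus; [exact hf|].
    apply is_derive_scal, hg. }
  assert (cont : forall f g x, continuity f -> continuity g ->
    continuity_pt (fun y => f y - s * g y) x).
  { intros f g x hf hg; apply continuity_pt_minus; [apply hf|].
    apply continuity_pt_scal, hg. }
  assert (hG : forall y, 0 <= y <= 1 -> 0 <= G1 y - s * G2 y).
  { apply (concave_nonneg (fun y => G1 y - s * G2 y)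
      (fun y => K1 y - s * K2 y)
      (fun y => - (1 - y) * Rpower (F1 y) m - s * (- (1 - y) * Rpower (F2 y) m))).
    - intros y _; apply cont; assumption.
    - intros y hy; apply lin; auto.
    - intros y hy; apply lin; auto.
    - intros y hy.
      assert (q := pos' y hy).
      assert (h : s * Rpower (F2 y) m <= Rpower (F1 y) m).
      { unfold s; rewrite Rpower_mult_distr by lra.
        apply Rle_Rpower_l; [lra|]; split; [nra | apply hle; lra]. }
      nra.
    (* At [0] the difference of slopes is [theta * (1 - s)], nonnegative as [s <= 1]. *)
    - rewrite e1, e1'; nra.
    - rewrite e2, e2'; lra. }
  intros x hx.
  assert (h : 0 <= F1 x - s * F2 x); [|lra].
  apply (nondecreasing_nonneg (fun y => F1 y - s * F2 y)
    (fun y => G1 y - s * G2 y) 0 1); [| | | |exact hx].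
  - intros y _; apply cont; assumption.
  - intros y hy; apply lin; auto.
  - intros y hy; apply hG; lra.
  - rewrite e0, e0'; lra.
Qed.

End Profiles.

(** * The largest admissible factor, and uniqueness *)

Lemma profile_le (theta m : R) (F1 G1 K1 F2 G2 K2 : R -> R) :
  0 < theta -> 0 < m < 1 ->
  film_profile theta m F1 G1 K1 -> film_profile theta m F2 G2 K2 ->
  forall x, 0 <= x <= 1 -> F2 x <= F1 x.
Proof.
  intros htheta hm p1 p2.
  assert (low1 := profile_lower_bound _ _ _ _ _ htheta p1).
  assert (low2 := profile_lower_bound _ _ _ _ _ htheta p2).
  destruct (profile_upper_bound _ _ _ _ _ p2) as [M [hM up]].
  set (E := fun t => 0 <= t <= 1 /\ forall x, 0 <= x <= 1 -> t * F2 x <= F1 x).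
  (* Chosen so that [t0 * F2 x <= t0 * M * x <= theta / 2 * x <= F1 x]. *)
  set (t0 := Rmin 1 (theta / 2 / M)).
  assert (ht0 : 0 < t0).
  { apply Rmin_glb_lt; [lra|]; apply Rdiv_lt_0_compat; lra. }
  assert (Et0 : E t0).
  { split; [split; [lra | apply Rmin_l]|]; intros x hx.
    assert (h : t0 * M <= theta / 2).
    { apply Rle_trans with (theta / 2 / M * M).
      - apply Rmult_le_compat_r; [lra | apply Rmin_r].
      - right; field; lra. }
    assert (h1 := low1 x hx); assert (h2 := up x hx).
    assert (t0 * F2 x <= t0 * (M * x)) by (apply Rmult_le_compat_l; lra).
    assert (t0 * M * x <= theta / 2 * x) by (apply Rmult_le_compat_r; lra).
    lra. }
  destruct (completeness E) as [T [hub hlub]].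
  { exists 1; intros t [h _]; lra. }
  { exists t0; exact Et0. }
  assert (hT0 : 0 < T) by (assert (h := hub t0 Et0); lra).
  assert (hT1 : T <= 1) by (apply hlub; intros t [h _]; lra).
  (* The supremum is itself admissible: where it failed, [F2 x] would be positive and [F1 x / F2 x]
     an upper bound of [E] below [T]. *)
  assert (ET : forall x, 0 <= x <= 1 -> T * F2 x <= F1 x).
  { intros x hx.
    destruct (Rle_lt_dec (T * F2 x) (F1 x)) as [h | h]; [exact h | exfalso].
    assert (h1 := low1 x hx); assert (h2 := low2 x hx).
    assert (0 < F2 x) by nra.
    assert (hT : T <= F1 x / F2 x).
    { apply hlub; intros t [_ ht].
      apply Rle_div_r; [lra | apply ht, hx]. }
    apply Rle_div_r in hT; lra. }
  destruct (Rlt_le_dec T 1) as [h | h].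
  - exfalso.
    (* As [m < 1] and [ln T < 0], [m * ln T > ln T]; so [T^m] would be an admissible factor above
       the supremum. *)
    assert (hl : ln T < 0) by (rewrite <- ln_1; apply ln_increasing; lra).
    assert (hlt : T < Rpower T m).
    { rewrite <- (exp_ln T) at 1 by lra; apply exp_increasing; nra. }
    assert (Rpower T m <= T); [|lra].
    apply hub; split.
    + split; [lra | apply Rpower_le_1; lra].
    + apply (profile_improve theta m F1 G1 K1 F2 G2 K2); auto; lra.
  - intros x hx; assert (e : T = 1) by lra; assert (h1 := ET x hx).
    rewrite e in h1; lra.
Qed.

Theorem proposition5p6 (theta n : R) (htheta : 0 < theta) (hn : 0 < n < 1)
  (H1 H2 : R -> R)
  (hH1 : film_solution theta n H1) (hH2 : film_solution theta n H2) :
  forall x : R, 0 <= x <= 1 -> H1 x = H2 x.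
Proof.
  destruct (film_solution_profile _ _ _ hH1) as [F1 [G1 [K1 [p1 e1]]]].
  destruct (film_solution_profile _ _ _ hH2) as [F2 [G2 [K2 [p2 e2]]]].
  assert (hm : 0 < 1 - n < 1) by lra.
  intros x hx; rewrite <- e1, <- e2 by exact hx.
  apply Rle_antisym.
  - exact (profile_le _ _ _ _ _ _ _ _ htheta hm p2 p1 x hx).
  - exact (profile_le _ _ _ _ _ _ _ _ htheta hm p1 p2 x hx).
Qed.
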